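(* Let $(\Gamma,\sigma)$ be a consistent connection graph, where $\Gamma$ is a locally finite weighted graph (finite or infinite) and $\sigma:E(\Gamma)\to O(d)$. Let $H_t^{\sigma}=\exp(-t\mathcal{L}^{\sigma})$ be its connection heat kernel and $H_t=\exp(-t\mathcal{L})$ the heat kernel of the underlying graph $\Gamma$. Then for all vertices $x,y$ joined by a path, $$H_t^{\sigma}(x,y)=H_t(x,y)\,\sigma_{P_{x\rightarrow y}},$$ where $\sigma_{P_{x\to y}}$ is the signature of any path from $x$ to $y$.
   Context: $\Gamma=(V,E,w)$ is an undirected graph with symmetric positive edge weights, $d(u)=\sum_{v\sim u}w_{uv}$. A connection assigns to each ordered pair of adjacent vertices $(u,v)$ a matrix $\sigma_{uv}\in O(d)$ with $\sigma_{vu}=\sigma_{uv}^{-1}$. The normalized Laplacian is $\mathcal{L}=I-D^{-1/2}AD^{-1/2}$ ($D$ the diagonal degree matrix, $A$ the weighted adjacency matrix), and the normalized connection Laplacian is $\mathcal{L}^{\sigma}=I-(D^{\sigma})^{-1/2}A^{\sigma}(D^{\sigma})^{-1/2}$, where $D^{\sigma}$ is block diagonal with blocks $d(u)I_d$ and $A^{\sigma}$ has block $w_{uv}\sigma_{uv}$ at $(u,v)$ if $u\sim v$, else $0$. $H_t(x,y)$ is the $(x,y)$ entry of $e^{-t\mathcal{L}}$ (a number) and $H^{\sigma}_t(x,y)$ the $(x,y)$ $d\times d$ block of $e^{-t\mathcal{L}^{\sigma}}$. The signature of a path (or walk) $P:x_0\sim\cdots\sim x_m$ is $\sigma_P=\sigma_{x_0x_1}\cdots\sigma_{x_{m-1}x_m}$.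 $(\Gamma,\sigma)$ is consistent if the signature of every cycle is the identity matrix (so the signature of a path depends only on its endpoints). *)

(* Defs.v *)
From HB Require Import structures.
From mathcomp Require Import all_boot all_order all_algebra.
From mathcomp Require Import all_classical all_reals all_analysis.
Set Implicit Arguments.
Unset Strict Implicit.
Unset Printing Implicit Defensive.
Import Order.TTheory GRing.Theory Num.Theory.
Import numFieldNormedType.Exports.
Local Open Scope classical_set_scope.
Local Open Scope ring_scope.

(* Real matrices indexed by an arbitrary, possibly infinite, type. The sums
   below are finite-support sums, hence equal 0 when the support is infinite;
   for matrices with finitely many nonzero entries in each row, such as all
   those built from a locally finite graph, they are the usual ones. *)
Section InfiniteMatrices.
Variables (R : realType) (I : choiceType).
Implicit Types A B : I -> I -> R.

Definition idiag (f : I -> R) : I -> I -> R :=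
  fun x y => if x == y then f x else 0.

Definition iid : I -> I -> R := idiag (fun=> 1).

Definition imul A B : I -> I -> R :=
  fun x y => \sum_(z \in [set: I]) A x z * B z y.

Definition ipow A (k : nat) : I -> I -> R := iter k (imul A) iid.

(* Entries of the exponential series. For the normalized Laplacians, which are
   bounded on l^2 when the graph is locally finite, this series converges to
   the matrix entries of the operator exponential. *)
Definition imexp A : I -> I -> R :=
  fun x y => limn (series (fun k : nat => ipow A k x y / k`!%:R)).

End InfiniteMatrices.

Record wgraph (R : realType) (V : choiceType) := WGraph {
  adj : rel V;
  weight : V -> V -> R;
  adj_sym : symmetric adj;
  weight_sym : forall u v, adj u v -> weight u v = weight v u;
  weight_gt0 : forall u v, adj u v -> 0 < weight u v
}.

Definition locally_finite (R : realType) (V : choiceType) (G : wgraph R V) :=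
  forall u, finite_set [set v | adj G u v].

Definition orthogonal_mx (R : realType) (d : nat) (M : 'M[R]_d) :=
  M *m M^T = 1%:M.

(* The values of sg on non-adjacent pairs are irrelevant. *)
Record connection (R : realType) (V : choiceType) (G : wgraph R V) (d : nat) :=
  Connection {
    sg :> V -> V -> 'M[R]_d;
    sg_orthogonal : forall u v, adj G u v -> orthogonal_mx (sg u v);
    sg_inv : forall u v, adj G u v -> sg v u = invmx (sg u v)
  }.

Section HeatKernels.
Variables (R : realType) (V : choiceType) (G : wgraph R V).

Definition degree (u : V) : R := \sum_(v \in [set v | adj G u v]) weight G u v.

Definition adjacency : V -> V -> R :=
  fun u v => if adj G u v then weight G u v else 0.

(* At an isolated vertex the entry of D^{-1/2} is 0^-1 = 0. *)
Definition Dinvsqrt : V -> V -> R := idiag (fun u => (Num.sqrt (degree u))^-1).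

Definition laplacian : V -> V -> R :=
  fun u v => iid R u v - imul (imul Dinvsqrt adjacency) Dinvsqrt u v.

Definition heat_kernel (t : R) : V -> V -> R :=
  imexp (fun u v => - t * laplacian u v).

Variables (d : nat) (s : connection G d).

(* Block matrices with d x d blocks are indexed by (vertex, coordinate). *)
Definition conn_adjacency : V * 'I_d -> V * 'I_d -> R :=
  fun a b => if adj G a.1 b.1 then weight G a.1 b.1 * s a.1 b.1 a.2 b.2 else 0.

Definition conn_Dinvsqrt : V * 'I_d -> V * 'I_d -> R :=
  idiag (fun a => (Num.sqrt (degree a.1))^-1).

Definition conn_laplacian : V * 'I_d -> V * 'I_d -> R :=
  fun a b => iid R a b -
    imul (imul conn_Dinvsqrt conn_adjacency) conn_Dinvsqrt a b.

Definition conn_heat_kernel (t : R) (x y : V) : 'M[R]_d :=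
  \matrix_(i, j) imexp (fun a b => - t * conn_laplacian a b) (x, i) (y, j).

(* Signature of the walk x :: p. *)
Fixpoint signature (x : V) (p : seq V) : 'M[R]_d :=
  if p is y :: q then s x y *m signature y q else 1%:M.

(* A cycle x_0 ~ ... ~ x_(m-1) ~ x_0 with distinct x_i is given by
   c = [:: x_0; ...; x_(m-1)]. The case m = 2 imposes nothing, by sg_inv;
   the case m = 1 is that of a loop. *)
Definition consistent :=
  forall (x : V) (q : seq V), ucycle (adj G) (x :: q) ->
    signature x (rcons q x) = 1%:M.

End HeatKernels.

(* Main.v *)
(* Consistency makes the signature of a walk depend only on its endpoints: a
   closed walk that is not a simple cycle splits at a repeated vertex into two
   shorter closed walks. Hence every entry of L^sigma is the corresponding
   entry of L times a signature, signatures along walks telescope in matrix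
   products, and the k-th powers of -t L^sigma and -t L differ by the factor
   sigma_P. To pass to the limit one needs the scalar exponential series to
   converge: u |-> sqrt(d(u)) is a positive weight that |L| multiplies by at
   most 2, so that |(-t L)^k(x,y)| <= (2|t|)^k sqrt(d(x)) / sqrt(d(y)). *)
Require Import Defs.
From HB Require Import structures.
From mathcomp Require Import all_boot all_order all_algebra.
From mathcomp Require Import all_classical all_reals all_analysis.
From mathcomp Require Import zify ring.
Set Implicit Arguments.
Unset Strict Implicit.
Unset Printing Implicit Defensive.
Import Order.TTheory GRing.Theory Num.Theory.
Import numFieldNormedType.Exports.
Local Open Scope ring_scope.

Lemma not_uniq_split (T : eqType) (r : seq T) : ~~ uniq r ->
  exists r1 v r2 r3, r = r1 ++ v :: r2 ++ v :: r3.
Proof.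
elim: r => //= a r IHr; rewrite negb_and negbK => /orP[|/IHr].
  by case/splitPr=> r2 r3; exists [::], a, r2, r3.
by case=> r1 [v] [r2] [r3 ->]; exists (a :: r1), v, r2, r3.
Qed.

Section Signatures.
Variables (R : realType) (V : choiceType) (G : wgraph R V) (d : nat).
Variable s : connection G d.

Lemma signature_cat (x : V) (p q : seq V) :
  signature s x (p ++ q) = signature s x p *m signature s (last x p) q.
Proof. by elim: p x => [|z p IHp] x /=; rewrite ?mul1mx// IHp mulmxA. Qed.

(** Orthogonality makes [s u v] a unit, so that [invmx] is a genuine inverse here. *)
Lemma mul_sg_sym (u v : V) : adj G u v -> s u v *m s v u = 1%:M.
Proof.
move=> uv; have [u_unit _] := mulmx1_unit (sg_orthogonal s uv).
by rewrite (sg_inv s uv) mulmxV.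
Qed.

Hypothesis hs : consistent s.

Lemma signature_closed (x : V) (p : seq V) :
  path (adj G) x p -> last x p = x -> signature s x p = 1%:M.
Proof.
have [n] := ubnP (size p); elim: n => // n IHn in x p *.
case/lastP: p => [//|q z]; rewrite last_rcons size_rcons ltnS => lt_qn + zx.
rewrite {z}zx => xq.
have [Uxq|/not_uniq_split] := boolP (uniq (x :: q)).
  by apply: hs; rewrite /ucycle /= xq.
(* If the repeated vertex is [x] itself, the walk is two closed walks at [x]. Otherwise the loop at
   [v] is cut out first, and the two outer pieces glue to a shorter closed walk at [x]. *)
case=> -[|a r1] [v] [r2] [r3] /= [xE eq_q]; rewrite {}eq_q -?{}xE in xq lt_qn *.
  move: xq lt_qn; rewrite -cat_rcons rcons_cat cat_path last_rcons size_cat.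
  rewrite size_rcons.
  case/andP=> xr2 xr3 lt_n; rewrite signature_cat last_rcons.
  by rewrite !IHn ?mul1mx ?last_rcons// size_rcons; lia.
move: xq lt_qn.
rewrite -cat_rcons -cat_rcons !rcons_cat !cat_path !last_rcons.
rewrite !size_cat !size_rcons.
case/and3P=> xr1 vr2 vr3 lt_n; rewrite !signature_cat !last_rcons.
rewrite (IHn v (rcons r2 v)) ?last_rcons ?size_rcons ?mul1mx//; last by lia.
rewrite -{2}(last_rcons x r1 v) -signature_cat IHn//.
- by rewrite size_cat !size_rcons; lia.
- by rewrite cat_path xr1 last_rcons.
- by rewrite last_cat !last_rcons.
Qed.

End Signatures.

Section FiniteSums.
Variables (R : realType) (I : choiceType).
Implicit Types A B : I -> I -> R.

(** Any duplicate-free list covering the support turns the finite-support sum into an ordinary one,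
    away from its default value 0. *)
Lemma imul_seq A B (r : seq I) (x y : I) : uniq r ->
    (forall z, z \notin r -> A x z * B z y = 0) ->
  imul A B x y = \sum_(z <- r) A x z * B z y.
Proof.
move=> Ur r0; rewrite (bigfs _ Ur) => [|z _ /r0//].
by apply: eq_fsbigl; apply/seteqP; split.
Qed.

Lemma imul_diagl A f (x y : I) : imul (idiag f) A x y = f x * A x y.
Proof.
rewrite (imul_seq (r := [:: x])) ?big_seq1 /idiag ?eqxx//= => z.
by rewrite inE eq_sym => /negPf->; rewrite mul0r.
Qed.

Lemma imul_diagr A f (x y : I) : imul A (idiag f) x y = A x y * f y.
Proof.
rewrite (imul_seq (r := [:: y])) ?big_seq1 /idiag ?eqxx//= => z.
by rewrite inE => /negPf->; rewrite mulr0.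
Qed.

Lemma ipowS A k (x y : I) : ipow A k.+1 x y = imul A (ipow A k) x y.
Proof. by []. Qed.

End FiniteSums.

Section Laplacians.
Variables (R : realType) (V : choiceType) (G : wgraph R V).

Lemma laplacianE (x y : V) : laplacian G x y =
  (x == y)%:R -
  (Num.sqrt (degree G x))^-1 * adjacency G x y * (Num.sqrt (degree G y))^-1.
Proof.
by rewrite /laplacian imul_diagr imul_diagl /iid /idiag; case: eqP.
Qed.

Lemma adjacency_ge0 (x y : V) : 0 <= adjacency G x y.
Proof. by rewrite /adjacency; case: ifP => // /weight_gt0/ltW. Qed.

(** The vertex [x] joins its neighbours so that the list covers row [x] of the Laplacian, diagonal
    included. *)
Lemma locally_finite_seq (hlf : locally_finite G) (x : V) :
  exists r : seq V, [/\ uniq r, x \in r & forall z, adj G x z -> z \in r].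
Proof.
have /finite_seqP[r xr] := hlf x; exists (undup (x :: r)).
split; first exact: undup_uniq.
  by rewrite mem_undup mem_head.
move=> z xz; rewrite mem_undup inE; apply/orP; right.
by have : [set v | adj G x v]%classic z by []; rewrite xr.
Qed.

Lemma degree_seq (x : V) (r : seq V) : uniq r ->
  (forall z, adj G x z -> z \in r) ->
  degree G x = \sum_(z <- r) adjacency G x z.
Proof.
move=> Ur xr; rewrite -big_mkcond (bigfs _ Ur)// => z /xr.
by move=> + /negP.
Qed.

Lemma laplacian_out (x z : V) (r : seq V) : x \in r ->
  (forall z, adj G x z -> z \in r) -> z \notin r -> laplacian G x z = 0.
Proof.
move=> xr nr zr; rewrite laplacianE /adjacency ifN; last first.
  by apply: contra zr => /nr.
by rewrite mulr0 mul0r subr0; case: eqP zr => // <-; rewrite xr.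
Qed.

(* The value 1 at isolated vertices keeps the weight positive everywhere. *)
Definition sqrt_degree (x : V) : R :=
  if Num.sqrt (degree G x) == 0 then 1 else Num.sqrt (degree G x).

Lemma sqrt_degree_gt0 (x : V) : 0 < sqrt_degree x.
Proof.
by rewrite /sqrt_degree; case: ifPn => // d0; rewrite lt0r d0 sqrtr_ge0.
Qed.

(** The identity contributes [sqrt_degree x] once. In the adjacency part the weight at [z] absorbs
    the right factor of D^{-1/2}, leaving d(x)^{-1/2} d(x), at most [sqrt_degree x] again. *)
Lemma laplacian_row_bound (x : V) (r : seq V) :
    uniq r -> x \in r -> (forall z, adj G x z -> z \in r) ->
  \sum_(z <- r) `|laplacian G x z| * sqrt_degree z <= 2 * sqrt_degree x.
Proof.
move=> Ur xr nr; have s0 z : 0 <= (Num.sqrt (degree G z))^-1.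
  by rewrite invr_ge0 sqrtr_ge0.
apply: (@le_trans _ _ (\sum_(z <- r) ((x == z)%:R * sqrt_degree x +
    (Num.sqrt (degree G x))^-1 * adjacency G x z))).
  apply: ler_sum => z _; rewrite laplacianE.
  apply: (@le_trans _ _ (((x == z)%:R + (Num.sqrt (degree G x))^-1 *
    adjacency G x z * (Num.sqrt (degree G z))^-1) * sqrt_degree z)).
    apply: ler_wpM2r; first exact/ltW/sqrt_degree_gt0.
    apply: (le_trans (ler_normB _ _)).
    by rewrite !ger0_norm// ?mulr_ge0// adjacency_ge0.
  rewrite mulrDl lerD//; first by case: eqP => [->|_]; rewrite ?mul0r.
  rewrite -mulrA ler_piMr ?mulr_ge0 ?adjacency_ge0//.
  rewrite /sqrt_degree; case: ifPn => [/eqP->|d0]; first by rewrite invr0 mul0r.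
  by rewrite mulVf.
rewrite big_split /= -mulr_sumr -degree_seq// mulr_natl mulr2n lerD//.
  rewrite (bigD1_seq x)//= eqxx mul1r big1 ?addr0// => z.
  by rewrite eq_sym => /negPf->; rewrite mul0r.
rewrite /sqrt_degree; case: ifPn => [/eqP->|d0]; first by rewrite invr0 mul0r.
have dx : 0 <= degree G x.
  by rewrite (degree_seq Ur nr) sumr_ge0// => z _; exact: adjacency_ge0.
by rewrite -{2}(sqr_sqrtr dx) expr2 mulKf.
Qed.

(** Powers unfold on the left, so the induction varies [x] with [y] fixed; each factor costs |t|
    times the row bound 2. *)
Lemma ipow_laplacian_bound (hlf : locally_finite G) (t : R) (k : nat)
    (x y : V) :
  `|ipow (fun u v => - t * laplacian G u v) k x y| * sqrt_degree y <=
  (2 * `|t|) ^+ k * sqrt_degree x.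
Proof.
elim: k x => [|k IHk] x.
  rewrite expr0 mul1r /ipow /= /iid /idiag.
  case: eqP => [->|_]; first by rewrite normr1 mul1r.
  by rewrite normr0 mul0r ltW ?sqrt_degree_gt0.
have [r [Ur xr nr]] := locally_finite_seq hlf x.
rewrite ipowS (imul_seq Ur); last first.
  by move=> z zr; rewrite (laplacian_out xr nr zr) mulr0 mul0r.
apply: (@le_trans _ _ (\sum_(z <- r) (2 * `|t|) ^+ k * `|t| *
    (`|laplacian G x z| * sqrt_degree z))).
  apply: (@le_trans _ _ ((\sum_(z <- r) `|(- t * laplacian G x z) *
     ipow (fun u v => - t * laplacian G u v) k z y|) * sqrt_degree y)).
    by apply: ler_wpM2r; [exact/ltW/sqrt_degree_gt0|exact: ler_norm_sum].
  rewrite mulr_suml; apply: ler_sum => z _.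
  rewrite 2!normrM normrN -[leLHS]mulrA.
  apply: (le_trans (ler_wpM2l _ (IHk z))); first by rewrite mulr_ge0.
  by rewrite le_eqVlt; apply/predU1P; left; ring.
rewrite -mulr_sumr exprSr.
apply: (le_trans (ler_wpM2l _ (laplacian_row_bound Ur xr nr))).
  by rewrite mulr_ge0// exprn_ge0// mulr_ge0.
by rewrite le_eqVlt; apply/predU1P; left; ring.
Qed.

Lemma cvg_heat_kernel_series (hlf : locally_finite G) (t : R) (x y : V) :
  cvgn (series (fun k : nat =>
    ipow (fun u v => - t * laplacian G u v) k x y / k`!%:R)).
Proof.
apply: normed_cvg.
pose c := sqrt_degree x / sqrt_degree y.
have c0 : 0 <= c by rewrite divr_ge0// ltW// sqrt_degree_gt0.
(* Domination by [c] times the exponential series at 2|t|. *)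
apply: (@series_le_cvg _ _ (c *: exp_coeff (2 * `|t|))) => [k|k|k|].
- exact: normr_ge0.
- by rewrite mulr_ge0// divr_ge0// exprn_ge0// mulr_ge0.
- rewrite /= normrM normfV normr_nat.
  have -> : (c *: exp_coeff (2 * `|t|)) k = c * (2 * `|t|) ^+ k / k`!%:R.
    by rewrite -mulrA.
  rewrite ler_wpM2r ?invr_ge0//.
  rewrite /c mulrAC ler_pdivlMr ?sqrt_degree_gt0// [leRHS]mulrC.
  exact: ipow_laplacian_bound.
- by apply: is_cvg_seriesZ; exact: is_cvg_series_exp_coeff.
Qed.

Variables (d : nat) (s : connection G d).
Hypotheses (hlf : locally_finite G) (hs : consistent s).

(* At x = z the diagonal of the Laplacian asks for the identity, which a loop
   also carries by consistency. *)
Lemma conn_laplacianE (x z : V) (i j : 'I_d) :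
  conn_laplacian s (x, i) (z, j) =
  laplacian G x z * (if x == z then 1%:M else s x z) i j.
Proof.
rewrite /conn_laplacian imul_diagr imul_diagl laplacianE /iid /idiag /=.
rewrite /conn_adjacency /adjacency /= xpair_eqE.
have [<-{z}|_] /= := eqVneq x z; last by case: ifP => _; ring.
rewrite mxE; case: (boolP (adj G x x)) => [xx|_]; last first.
  by case: (i == j) => /=; ring.
have -> : s x x = 1%:M.
  by have := hs (x := x) (q := [::]); rewrite /ucycle /= xx mulmx1; apply.
by rewrite mxE; case: (i == j) => /=; ring.
Qed.

(** The walk [p] varies in the induction, since the hypothesis at an intermediate vertex [z] needs a
    walk from [z] to [y]. *)
Lemma ipow_conn_laplacian (t : R) (k : nat) (x y : V) (p : seq V) (i j : 'I_d) :
    path (adj G) x p -> last x p = y ->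
  ipow (fun a b => - t * conn_laplacian s a b) k (x, i) (y, j) =
  ipow (fun u v => - t * laplacian G u v) k x y * signature s x p i j.
Proof.
elim: k => [|k IHk] in x p i * => xp py.
  rewrite /ipow /= /iid /idiag xpair_eqE.
  case: eqP => [xy|_] /=; last by rewrite mul0r.
  (* For [k = 0] only x = y matters, where [p] is closed. *)
  by rewrite (signature_closed hs xp) ?mxE ?mul1r ?py//; case: eqP.
have [r [Ur xr nr]] := locally_finite_seq hlf x.
rewrite !ipowS (imul_seq Ur); last first.
  by move=> z zr; rewrite (laplacian_out xr nr zr) mulr0 mul0r.
rewrite (imul_seq (r := [seq (z, l) | z <- r, l <- enum 'I_d])); first last.
- case=> z l zl; rewrite conn_laplacianE (laplacian_out xr nr).
    by rewrite mul0r mulr0 mul0r.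
  apply: contra zl => zr; apply/allpairsP.
  by exists (z, l); rewrite /= mem_enum.
- by apply: allpairs_uniq => //; [exact: enum_uniq|case=> ? ? []].
rewrite big_allpairs mulr_suml; apply: eq_bigr => z _; rewrite big_enum /=.
set g := if x == z then 1%:M else s x z.
(* A nonzero entry forces z = x or [z] adjacent to [x], which provides a walk from [z] to [y]. *)
have [L0|] := eqVneq (laplacian G x z) 0.
  by rewrite big1 => [|l _]; rewrite ?conn_laplacianE L0 ?mul0r ?mulr0 !mul0r.
move=> Lxz.
have [q [zq qy gq]] : exists q,
    [/\ path (adj G) z q, last z q = y &
        g *m signature s z q = signature s x p].
  rewrite /g; have [<-|xz] := eqVneq x z; first by exists p; rewrite mul1mx.
  have {Lxz} xz_adj : adj G x z.
    apply: contraNT Lxz => /negPf nxz.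
    by rewrite laplacianE /adjacency nxz (negPf xz) mulr0 mul0r subr0.
  (* Step back from [z] to [x], then follow [p]: the signatures of the edge in its two directions
     cancel. *)
  exists (x :: p); rewrite /= adj_sym xz_adj; split=> //.
  by rewrite mulmxA mul_sg_sym// mul1mx.
rewrite -gq mxE mulr_sumr; apply: eq_bigr => l _.
by rewrite conn_laplacianE -/g (IHk _ _ _ zq qy); ring.
Qed.

End Laplacians.

Theorem theorem5 (R : realType) (V : choiceType) (G : wgraph R V) (d : nat)
  (s : connection G d) (hlf : locally_finite G) (hs : consistent s)
  (t : R) (x y : V) (p : seq V)
  (hp : path (adj G) x p) (hy : last x p = y) :
  conn_heat_kernel s t x y = heat_kernel G t x y *: signature s x p.
Proof.
apply/matrixP => i j; rewrite !mxE mulrC.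
(* Convergence of the scalar series lets the signature entry pass inside the limit; the two series
   then agree term by term. *)
rewrite -[RHS](lim_seriesZ _ (@cvg_heat_kernel_series _ _ _ hlf t x y)) /imexp.
congr (limn (series _)); apply/funext => k.
by rewrite (ipow_conn_laplacian hlf hs t k i j hp hy) mulrAC mulrC.
Qed.
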